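(* Let $\mathcal{K}=\{x\in\mathbb{R}^n : g_i(x)\ge 0,\ i=1,\dots,m\}$, where $g_1,\dots,g_m$ are real multivariate polynomials, be compact with non-empty interior, and let $\mathcal{B}=\{x\in\mathbb{R}^n : a_i\le x_i\le b_i,\ i=1,\dots,n\}$ be a hyperrectangle with $\mathcal{B}\supseteq\mathcal{K}$. For $j=1,\dots,m$ let $\mathcal{K}_j:=\{x\in\mathbb{R}^n : g_j(x)<0\}$. For each $d\in\mathbb{N}$ let $p_d^*$ attain the minimum in $$\min\Big\{\|p\|_1 : p\in P_d,\ p\ge 0\text{ on }\mathcal{B},\ p\ge 1\text{ on }\mathcal{K}_j\cap\mathcal{B}\text{ for } j=1,\dots,m\Big\},$$ where $\|p\|_1:=\int_{\mathcal{B}}p(x)\,dx$, and let $\mathcal{V}(p_d^* ):=\{x\in\mathcal{B} : p_d^*(x)\le 1\}$. Then for all $d\in\mathbb{N}$ it holds that $\mathcal{V}(p_d^* )\subseteq\mathcal{K}$. Moreover, $\lim_{d\to\infty}\mathrm{vol}\,\mathcal{V}(p_d^* )=\mathrm{vol}\,\mathcal{K}$.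
   Context: $P_d$ denotes the set of real polynomials in $n$ variables of degree at most $d$. $\mathrm{vol}$ denotes Lebesgue measure on $\mathbb{R}^n$. On the feasible set $p\ge 0$ on $\mathcal{B}$, so $\int_{\mathcal{B}}p(x)\,dx$ is the $L^1$ norm of $p$ on $\mathcal{B}$.
   Formalization: The inclusion is stated for {x in B : p_d*(x) < 1} instead of {x in B : p_d*(x) ≤ 1}, because the literal one fails (d = 0, B not contained in K: p_0* = 1 and V(p_0* ) = B). The volume limit is stated for both sets. *)

(* Defs.v *)
(* The notations of mpoly clash with those of MathComp-Analysis; its names and
   canonical structures do not, as long as it is imported first. *)
From HB Require Import structures.
From mathcomp Require Import all_boot all_order all_algebra.
From mathcomp Require Import -(notations) mpoly.
From mathcomp Require Import all_classical all_reals all_analysis.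

Set Implicit Arguments.
Unset Strict Implicit.
Unset Printing Implicit Defensive.

Import Order.TTheory GRing.Theory Num.Theory.
Import numFieldNormedType.Exports.

Local Open Scope classical_set_scope.
Local Open Scope ring_scope.

(* MathComp-Analysis only provides Lebesgue measure on the line.  The row
   vectors 'rV[R]_n are given the sigma-algebra generated by the n coordinate
   maps to the Borel line (the Borel sigma-algebra of R^n). *)
Section measurable_rV.
Context (R : realType) (n : nat).

Definition rV_coord (i : 'I_n) (x : 'rV[R]_n) : measurableTypeR R := x ord0 i.

Let rV_set0 : g_sigma_preimage rV_coord set0.
Proof. exact: sigma_algebra0. Qed.

Let rV_setC A : g_sigma_preimage rV_coord A -> g_sigma_preimage rV_coord (~` A).
Proof. exact: sigma_algebraC. Qed.

Let rV_bigcup (F : _^nat) : (forall i, g_sigma_preimage rV_coord (F i)) ->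
  g_sigma_preimage rV_coord (\bigcup_i (F i)).
Proof. exact: sigma_algebra_bigcup. Qed.

HB.instance Definition _ :=
  @isMeasurable.Build (measure_tuple_display (R.-ocitv.-measurable).-sigma)
    'rV[R]_n (g_sigma_preimage rV_coord) rV_set0 rV_setC rV_bigcup.

Lemma measurable_rV_coord (i : 'I_n) :
  measurable_fun [set: 'rV[R]_n] (rV_coord i).
Proof.
move=> _ Y mY; rewrite setTI; apply: sub_sigma_algebra => /=.
rewrite -bigcup_seq/=; exists i => /=; first by rewrite mem_index_enum.
by exists Y => //; rewrite setTI.
Qed.

Lemma measurable_fun_rV d (T : measurableType d) (f : T -> 'rV[R]_n) :
  (forall i, measurable_fun [set: T] (rV_coord i \o f)) ->
  measurable_fun [set: T] f.
Proof.
move=> mf _ A mA; rewrite setTI.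
suff: g_sigma_preimage rV_coord `<=` [set B | measurable (f @^-1` B)].
  exact.
apply: smallest_sub.
  split.
  - by rewrite /= preimage_set0.
  - by move=> B /= mB; rewrite setTD preimage_setC; exact: measurableC.
  - by move=> F mF /=; rewrite preimage_bigcup; apply: bigcup_measurable => i _; exact: mF.
rewrite -bigcup_seq => B /= [i _] [Y mY <-].
by rewrite /= setTI -comp_preimage -[X in measurable X]setTI; exact: mf.
Qed.

End measurable_rV.

Section rV_cons.
Context (R : realType) (n : nat).

Definition rV_cons (z : measurableTypeR R * 'rV[R]_n) : 'rV[R]_n.+1 :=
  \row_i oapp (fun j => z.2 ord0 j) z.1 (unlift ord0 i).

Definition rV_uncons (x : 'rV[R]_n.+1) : measurableTypeR R * 'rV[R]_n :=
  (x ord0 ord0, \row_j x ord0 (lift ord0 j)).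

Lemma rV_consK : cancel rV_cons rV_uncons.
Proof.
case=> a v; rewrite /rV_uncons /rV_cons; congr pair.
  by rewrite mxE unlift_none.
by apply/rowP => j; rewrite !mxE liftK.
Qed.

Lemma measurable_rV_cons : measurable_fun setT rV_cons.
Proof.
apply: measurable_fun_rV => i; case: (unliftP ord0 i) => [j|] ->.
- rewrite (_ : _ \o _ = rV_coord j \o snd).
    by apply: measurableT_comp => //; exact: measurable_rV_coord.
  by apply/funext => z; rewrite /rV_coord/= mxE liftK.
- rewrite (_ : _ \o _ = fst); first exact: measurable_fst.
  by apply/funext => z; rewrite /rV_coord/= mxE unlift_none.
Qed.

Lemma measurable_rV_uncons : measurable_fun setT rV_uncons.
Proof.
apply/measurable_fun_pairP; split => /=.
  exact: (@measurable_rV_coord R n.+1 ord0).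
apply: measurable_fun_rV => j.
rewrite (_ : _ \o _ = rV_coord (lift ord0 j)); first exact: measurable_rV_coord.
by apply/funext => x; rewrite /rV_coord/= mxE.
Qed.

Variable mu : {sigma_finite_measure set 'rV[R]_n -> \bar R}.

Definition rV_cons_measure : set 'rV[R]_n.+1 -> \bar R :=
  pushforward (@lebesgue_measure R \x mu)%E rV_cons.

Let mpre A : measurable A -> measurable (rV_cons @^-1` A).
Proof.
move=> mA; rewrite -[X in measurable X]setTI.
exact: (measurable_rV_cons measurableT mA).
Qed.

Let rV_cons_measure0 : rV_cons_measure set0 = 0%E.
Proof. by rewrite /rV_cons_measure /pushforward preimage_set0 measure0. Qed.

Let rV_cons_measure_ge0 A : (0 <= rV_cons_measure A)%E.
Proof. by rewrite /rV_cons_measure /pushforward; apply: measure_ge0. Qed.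

Let rV_cons_measure_sigma_additive : semi_sigma_additive rV_cons_measure.
Proof.
move=> F mF tF mUF; rewrite /rV_cons_measure /pushforward preimage_bigcup.
apply: measure_semi_sigma_additive.
- by move=> i; exact: mpre.
- apply/trivIsetP => /= i j _ _ ij; rewrite -preimage_setI.
  by move/trivIsetP : tF => /(_ _ _ _ _ ij) ->//; rewrite preimage_set0.
- by rewrite -preimage_bigcup; exact: mpre.
Qed.

HB.instance Definition _ := isMeasure.Build _ _ _ rV_cons_measure
  rV_cons_measure0 rV_cons_measure_ge0 rV_cons_measure_sigma_additive.

Let rV_cons_measure_sigma_finite : sigma_finite setT rV_cons_measure.
Proof.
have /sigma_finiteP[F [FT ndF Foo]] := sigma_finiteT (@lebesgue_measure R).
have /sigma_finiteP[G [GT ndG Goo]] := sigma_finiteT mu.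
exists (fun i => rV_uncons @^-1` (F i `*` G i)).
  rewrite -preimage_bigcup -[LHS](preimage_setT rV_uncons); congr (_ @^-1` _).
  rewrite -setXTT FT GT; apply/seteqP; split => [[x y] /= [[i _ Fx] [j _ Gy]]|].
    exists (maxn i j) => //; split.
      by move: x Fx; apply/subsetPset/ndF/leq_maxl.
    by move: y Gy; apply/subsetPset/ndG/leq_maxr.
  by move=> [x y] [i _ [/= Fx Gy]]; split; exists i.
move=> i; have [[mF Fi] [mG Gi]] := (Foo i, Goo i); split.
  rewrite -[X in measurable X]setTI.
  by apply: (measurable_rV_uncons measurableT); exact: measurableX.
rewrite /rV_cons_measure /pushforward -comp_preimage.
rewrite (_ : _ \o _ = id); last by apply/funext; exact: rV_consK.
by rewrite product_measure1E// lte_mul_pinfty// ge0_fin_numE.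
Qed.

HB.instance Definition _ := Measure_isSigmaFinite.Build _ _ _ rV_cons_measure
  rV_cons_measure_sigma_finite.

End rV_cons.

(* The n-fold product of one-dimensional Lebesgue measure; on R^0 it is the unit
   mass at the only point. *)
Fixpoint lebesgue_rV (R : realType) (n : nat) :
    {sigma_finite_measure set 'rV[R]_n -> \bar R} :=
  match n with
  | 0 => dirac (0 : 'rV[R]_0)
  | k.+1 => rV_cons_measure (lebesgue_rV R k)
  end.

Definition peval (R : realType) (n : nat) (p : mpoly n R)
    (x : 'rV[R]_n) : R :=
  meval (fun i => x ord0 i) p.

Definition semialg (R : realType) (n m : nat) (g : 'I_m -> mpoly n R) :
    set 'rV[R]_n :=
  [set x | forall i, 0 <= peval (g i) x].

Definition negset (R : realType) (n m : nat) (g : 'I_m -> mpoly n R)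
    (j : 'I_m) : set 'rV[R]_n :=
  [set x | peval (g j) x < 0].

Definition hyperrectangle (R : realType) (n : nat) (a b : 'rV[R]_n) :
    set 'rV[R]_n :=
  [set x | forall i, a ord0 i <= x ord0 i <= b ord0 i].

Definition poly_norm1 (R : realType) (n : nat) (B : set 'rV[R]_n)
    (p : mpoly n R) : \bar R :=
  (\int[lebesgue_rV R n]_(x in B) (peval p x)%:E)%E.

(* [msize p] is 1 + the total degree of p, and 0 for p = 0. *)
Definition feasible (R : realType) (n m : nat) (g : 'I_m -> mpoly n R)
    (B : set 'rV[R]_n) (d : nat) (p : mpoly n R) : Prop :=
  [/\ (msize p <= d.+1)%N,
      forall x, B x -> 0 <= peval p x
    & forall j x, (negset g j `&` B) x -> 1 <= peval p x].

Definition is_minimizer (R : realType) (n m : nat) (g : 'I_m -> mpoly n R)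
    (B : set 'rV[R]_n) (d : nat) (p : mpoly n R) : Prop :=
  feasible g B d p /\
  forall q, feasible g B d q -> (poly_norm1 B p <= poly_norm1 B q)%E.

Definition sublevel1 (R : realType) (n : nat) (B : set 'rV[R]_n)
    (p : mpoly n R) : set 'rV[R]_n :=
  [set x | B x /\ peval p x <= 1].

(* A feasible p may take the value 1 at points of B outside the semialgebraic
   set (for d = 0 and B not contained in it, the minimizer is the constant 1),
   so only the strict sublevel set is always contained in it. *)
Definition strict_sublevel1 (R : realType) (n : nat) (B : set 'rV[R]_n)
    (p : mpoly n R) : set 'rV[R]_n :=
  [set x | B x /\ peval p x < 1].

(* Main.v *)
Require Import Defs.
From mathcomp Require Import all_boot all_order all_algebra.
From mathcomp Require Import -(notations) mpoly.
From mathcomp Require Import all_classical all_reals all_analysis.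
From mathcomp Require Import measurable_realfun.
From mathcomp Require Import finmap.
From mathcomp Require Import ring lra.
Import Order.TTheory GRing.Theory Num.Theory.
Import numFieldNormedType.Exports.

Set Implicit Arguments.
Unset Strict Implicit.
Unset Printing Implicit Defensive.

Local Open Scope classical_set_scope.
Local Open Scope ring_scope.

(** Write K for the semialgebraic set, B for the box, S_d for the strict
    sublevel set of p_d in B and V_d for the sublevel set.  A point of B outside
    K violates some constraint, so p_d >= 1 there: S_d is included in K.  Since
    p_d >= 0 on B and p_d >= 1 on B \ S_d, integrating gives
    [[ vol (B \ K) <= vol (B \ S_d) <= ||p_d||_1 ]]
    and everything rests on the right-hand side getting down to vol (B \ K).
    As p_d is optimal, it suffices to exhibit feasible polynomials q_k of any
    degree with ||q_k||_1 --> vol (B \ K) ([exists_approximants]).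

    These are explicit.  After rescaling each g_j to take values in [0, 1] with
    the sign change at 1/2, put
    [[ q_k = 1 - \prod_j step k (g_j) + 2^-k ]]
    where [step k] is a univariate polynomial that maps [0, 1] to itself, is at
    most 2^-k on the whole of [0, 1/2], and converges to 1 at every point of
    ]1/2, 1].  One violated constraint makes the product at most 2^-k, hence
    q_k >= 1 outside K.  Away from the zeros of the g_j the q_k converge to
    the indicator of B \ K, and they are bounded by 2, so dominated convergence
    applies: the zero set of a polynomial that is not identically zero is
    Lebesgue null ([lebesgue_rV_zeros]).  A constraint polynomial that vanishes
    identically is satisfied everywhere; it has to be left out of the product,
    for [step k] tends to 0 at 1/2.

    Finally V_d \ S_d lies in the zero set of p_d - 1, which is null unless p_d
    is constantly 1.  In that case S_d is empty, which is excluded for large d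
    by vol S_d --> vol K > 0; this is where the interior of K is used. *)

(** * Polynomial functions and Lebesgue measure on row vectors *)

Section polynomial_functions.
Context (R : realType).

Lemma measurable_peval n (p : mpoly n R) :
  measurable_fun [set: 'rV[R]_n] (peval p).
Proof.
rewrite (_ : peval p = fun x => \sum_(m <- msupp p)
    (mcoeff m p * \prod_(i < n) x ord0 i ^+ m i)); last first.
  by apply/funext => x; rewrite /peval mevalE.
apply: measurable_sum => m; apply: measurable_funM => //.
apply: measurable_prod => i _; apply: measurable_funX.
exact: (@measurable_rV_coord R n i).
Qed.

Lemma measurable_peval_preimage n (p : mpoly n R) (A : set R) :
  measurable A -> measurable (peval p @^-1` A).
Proof.
by move=> mA; rewrite -[X in measurable X]setTI; exact: measurable_peval.
Qed.

Lemma peval_bounded n (p : mpoly n R) (a b : 'rV[R]_n) :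
  exists2 M : R, 0 < M & forall x, hyperrectangle a b x -> `|peval p x| <= M.
Proof.
pose c i := Num.max `|a ord0 i| `|b ord0 i|.
exists (1 + \sum_(m <- msupp p) `|mcoeff m p| * \prod_(i < n) c i ^+ m i).
  rewrite ltr_wpDr// sumr_ge0// => m _; rewrite mulr_ge0// prodr_ge0// => i _.
  by rewrite exprn_ge0// le_max normr_ge0.
move=> x abx; apply: ler_wpDl => //; rewrite /peval mevalE.
apply: (le_trans (ler_norm_sum _ _ _)); apply: ler_sum => m _.
rewrite normrM ler_wpM2l// normr_prod; apply: ler_prod => i _.
rewrite normr_ge0 normrX lerXn2r ?nnegrE ?le_max ?normr_ge0//.
have /andP[ax xb] := abx i.
by rewrite -le_max ler_norml; have := ler_norm (b ord0 i);
  have := ler_norm (- a ord0 i); rewrite normrN /c; case: (leP `|a ord0 i|); lra.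
Qed.

(** This and [peval_line] split off the first variable, for the induction in
    [lebesgue_rV_zeros]: with that variable fixed the function stays polynomial in
    the others, and with the others fixed it has finitely many zeros or only
    zeros. *)
Lemma peval_slice n (p : mpoly n.+1 R) (t : R) :
  exists q : mpoly n R, forall y, peval q y = peval p (rV_cons (t, y)).
Proof.
pose h := [tuple oapp (fun j => mpolyX R (mnm1 j)) (mpolyC n t) (unlift ord0 i)
           | i < n.+1].
exists (comp_mpoly h p) => y; rewrite /peval comp_mpoly_meval.
apply: meval_eq => i; rewrite tnth_mktuple mxE.
by case: (unliftP ord0 i) => [j|] _ /=; rewrite ?mevalXU ?mevalC.
Qed.

Lemma peval_line n (p : mpoly n.+1 R) (y : 'rV[R]_n) :
  exists r : {poly R}, forall t, r.[t] = peval p (rV_cons (t, y)).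
Proof.
exists (mmap polyC
  (fun i => oapp (fun j => (y ord0 j)%:P) 'X (unlift ord0 i)) p) => t.
rewrite /peval mevalE /mmap horner_sum; apply: eq_bigr => m _.
rewrite hornerM hornerC /mmap1 horner_prod; congr (_ * _).
apply: eq_bigr => i _; rewrite horner_exp mxE.
by case: (unliftP ord0 i) => [j|] _ /=; rewrite ?hornerX ?hornerC.
Qed.

Lemma lebesgue_rVS n (A : set 'rV[R]_n.+1) :
  lebesgue_rV R n.+1 A =
  (\int[@lebesgue_measure R]_t lebesgue_rV R n [set y | A (rV_cons (t, y))])%E.
Proof.
rewrite /= /rV_cons_measure /pushforward /product_measure1.
by apply: eq_integral => t _ /=; rewrite xsectionE.
Qed.

Lemma finite_roots (r : {poly R}) : r != 0 -> finite_set [set t | r.[t] = 0].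
Proof.
move=> r0; apply: contrapT => /(infinite_set_fset (size r)) [B BA].
rewrite leqNgt => /negP; apply; apply: max_poly_roots => //.
  by apply/allP => t tB; apply/rootP/BA.
exact: fset_uniq.
Qed.

(** By Fubini it is enough that almost every slice {y | p (t, y) = 0} is null.
    By induction this holds as soon as p (t, .) is nonzero at the tail of [x0],
    and that only fails when t is a root of the univariate polynomial
    p (., tail of x0), which is nonzero at the head of [x0]. *)
Lemma lebesgue_rV_zeros n (p : mpoly n R) (x0 : 'rV[R]_n) :
  peval p x0 != 0 -> lebesgue_rV R n [set x | peval p x = 0] = 0%E.
Proof.
elim: n p x0 => [|n IH] p x0 px0.
  rewrite /= /dirac; rewrite (_ : [set x | _] = set0) ?indic0//.
  apply/seteqP; split => // x /= /eqP.
  by rewrite (_ : x = x0) ?(negbTE px0)//; apply/rowP; case.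
have mZ : measurable (peval p @^-1` [set 0]).
  exact: measurable_peval_preimage.
rewrite lebesgue_rVS.
apply: (etrans (ge0_ae_eq_integral (g := cst 0%E) _ _ _ _ _ _)) => //=.
- have := @measurable_fun_xsection _ _ _ _ R (lebesgue_rV R n)
    (@rV_cons R n @^-1` (peval p @^-1` [set 0])).
  rewrite (_ : (fun _ => _) = lebesgue_rV R n \o
    xsection (@rV_cons R n @^-1` (peval p @^-1` [set 0]))); last first.
    by apply/funext => t; rewrite /= xsectionE.
  apply; rewrite -[X in measurable X]setTI.
  exact: (@measurable_rV_cons R n measurableT).
- have [r rE] := peval_line p (rV_uncons x0).2.
  have x0E : rV_cons (rV_uncons x0) = x0.
    apply/rowP => i; rewrite mxE.
    by case: (unliftP ord0 i) => [j|] -> /=; rewrite ?mxE.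
  have r0 : r != 0.
    apply: contraNneq px0 => r0; rewrite -x0E [rV_uncons x0]surjective_pairing.
    by rewrite -rE r0 horner0.
  have fr := finite_set_countable (finite_roots r0).
  exists [set t | r.[t] = 0]; split.
  + exact: countable_measurable.
  + exact: countable_lebesgue_measure0.
  + move=> t /= zt; apply: contrapT => rt; apply: zt => _.
    have [q qE] := peval_slice p t.
    under eq_set => y do rewrite -qE.
    apply: (IH q (rV_uncons x0).2).
    by rewrite qE -rE; exact/eqP.
- by rewrite integral_cst// mul0e.
Qed.

Lemma measurable_hyperrectangle n (a b : 'rV[R]_n) :
  measurable (hyperrectangle a b).
Proof.
rewrite (_ : hyperrectangle a b =
    \bigcap_(i in [set: 'I_n]) (@rV_coord R n i @^-1` `[a ord0 i, b ord0 i])).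
  apply: fin_bigcap_measurable => // i _.
  by rewrite -[X in measurable X]setTI; exact: measurable_rV_coord.
apply/seteqP; split => [x abx i _|x abx i].
  by rewrite /= in_itv/=; exact: abx.
by have := abx i I; rewrite /= in_itv.
Qed.

Lemma lebesgue_rV_hyperrectangle n (a b : 'rV[R]_n) :
  lebesgue_rV R n (hyperrectangle a b) =
  (\prod_(i < n) Num.max 0 (b ord0 i - a ord0 i))%:E.
Proof.
elim: n a b => [|n IH] a b.
  rewrite big_ord0 /= /dirac indicE mem_set//; by case.
rewrite big_ord_recl.
pose c := (rV_uncons a).2; pose d := (rV_uncons b).2.
have -> : \prod_(i < n)
      Num.max 0 (b ord0 (lift ord0 i) - a ord0 (lift ord0 i)) =
    \prod_(i < n) Num.max 0 (d ord0 i - c ord0 i).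
  by apply: eq_bigr => i _; rewrite !mxE.
rewrite EFinM -IH /= /rV_cons_measure /pushforward.
rewrite (_ : _ @^-1` _ = `[a ord0 ord0, b ord0 ord0] `*` hyperrectangle c d).
  rewrite product_measure1E//; last exact: measurable_hyperrectangle.
  congr (_ * _)%E; apply: (etrans (lebesgue_measure_itv _)); rewrite /= lte_fin.
  by case: ltP => ab; congr (_%:E); [rewrite max_r|rewrite max_l]; lra.
apply/seteqP; split => -[t y] /=; rewrite in_itv/= => aby.
  split; first by have := aby ord0; rewrite mxE unlift_none.
  by move=> i; have := aby (lift ord0 i); rewrite !mxE liftK.
move=> i; rewrite mxE; case: (unliftP ord0 i) => [j|] -> /=; last exact: aby.1.
by have := aby.2 j; rewrite !mxE.
Qed.

End polynomial_functions.

(** * Polynomials close to a step function *)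

(** As 1 - (1 - u^m)^N is about min (1, N u^m), its threshold is at u^m = 1/N.
    With m = 2^k and N = 2^m / 2^k it is just right of 1/2: N u^m is equal to
    (2u)^m / 2^k, at most 2^-k for u <= 1/2 and unbounded in k for each u > 1/2.
    The definition is over any ring so that it applies to numbers as well as to
    multivariate polynomials. *)
Definition step (S : pzRingType) (k : nat) (u : S) : S :=
  1 - (1 - u ^+ (2 ^ k)) ^+ (2 ^ (2 ^ k - k)).

Lemma rmorph_step (S T : pzRingType) (f : {rmorphism S -> T}) k u :
  f (step k u) = step k (f u).
Proof. by rewrite /step !(rmorphB, rmorph1, rmorphXn). Qed.

Section step_real.
Context (R : realType).
Implicit Types (x u : R) (k N : nat).

Lemma bernoulli x N : -1 <= x -> 1 + N%:R * x <= (1 + x) ^+ N.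
Proof.
move=> x1; elim: N => [|N IH]; first by rewrite mul0r addr0 expr0.
rewrite exprS; apply: le_trans (ler_wpM2l _ IH); last by lra.
have : 0 <= N%:R * x ^+ 2 by rewrite mulr_ge0// sqr_ge0.
by rewrite -natr1 expr2; nra.
Qed.

Lemma step_itv01 k u : 0 <= u <= 1 -> 0 <= step k u <= 1.
Proof.
move=> /andP[u0 u1]; have um0 : 0 <= u ^+ (2 ^ k) by exact: exprn_ge0.
have um1 : u ^+ (2 ^ k) <= 1 by exact: exprn_ile1.
have v0 : 0 <= 1 - u ^+ (2 ^ k) by lra.
have v1 : 1 - u ^+ (2 ^ k) <= 1 by lra.
rewrite /step; have := exprn_ge0 (2 ^ (2 ^ k - k)) v0.
by have := exprn_ile1 (2 ^ (2 ^ k - k)) v0 v1; lra.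
Qed.

Lemma step_exponents k : (2 ^ (2 ^ k - k))%:R * 2 ^+ k = 2 ^+ (2 ^ k) :> R.
Proof.
by rewrite natrX -exprD subnK// ltnW// ltn_expl.
Qed.

(** Bernoulli's inequality with y = u^(2^k): (1 - y)^N >= 1 - N y. *)
Lemma step_left k u : 0 <= u <= 1 / 2 -> step k u <= 2^-1 ^+ k.
Proof.
move=> /andP[u0 u2]; set y := u ^+ (2 ^ k).
have yle : y <= (2^-1) ^+ (2 ^ k).
  by rewrite /y lerXn2r ?nnegrE//; lra.
have y1 : y <= 1 by apply: (le_trans yle); rewrite exprn_ile1//; lra.
have := @bernoulli (- y) (2 ^ (2 ^ k - k)); rewrite lerN2 => /(_ y1).
suff : (2 ^ (2 ^ k - k))%:R * y <= 2^-1 ^+ k by rewrite /step -/y; lra.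
rewrite exprVn -[leRHS]mul1r ler_pdivlMr ?exprn_gt0// mulrAC step_exponents.
by rewrite mulrC -ler_pdivlMr ?exprn_gt0// mul1r -exprVn.
Qed.

(** Bernoulli twice, with y = u^(2^(k+1)) and N the outer exponent.  First,
    (1 - y)^N <= 1 / (1 + y)^N <= 1 / (N y).  Then, for e = 2u - 1,
    N y = (1 + e)^(2^(k+1)) / 2^(k+1), where the numerator is the square of
    (1 + e)^(2^k) >= 2^k e; squaring is what beats the denominator, whence the
    shift of k by one. *)
Lemma step_right k u : 1 / 2 < u <= 1 ->
  1 - step k.+1 u <= 2 / (2 * u - 1) ^+ 2 * 2^-1 ^+ k.
Proof.
move=> /andP[u2 u1]; set e := 2 * u - 1; have e0 : 0 < e by rewrite /e; lra.
set N := (2 ^ (2 ^ k.+1 - k.+1))%N; set y := u ^+ (2 ^ k.+1).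
have y0 : 0 <= y by rewrite exprn_ge0//; lra.
have y1 : y <= 1 by rewrite exprn_ile1//; lra.
have NyE : N%:R * y * 2 ^+ k.+1 = ((1 + e) ^+ (2 ^ k)) ^+ 2.
  rewrite mulrAC step_exponents -exprMn -exprM -expnSr.
  by congr (_ ^+ _); rewrite /e; ring.
have Nyge : 2 ^+ k * e ^+ 2 / 2 <= N%:R * y.
  have h : 2 ^+ k * e <= (1 + e) ^+ (2 ^ k).
    rewrite -natrX; apply: le_trans (bernoulli _ _); lra.
  have h2 : (2 ^+ k * e) ^+ 2 <= N%:R * y * 2 ^+ k.+1.
    by rewrite NyE lerXn2r ?nnegrE// ?mulr_ge0 ?exprn_ge0//; lra.
  have p0 : 0 < 2 ^+ k :> R by rewrite exprn_gt0.
  rewrite -(ler_pM2r (_ : 0 < 2 ^+ k.+1)) ?exprn_gt0//.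
  apply: le_trans h2; rewrite [2 ^+ k.+1]exprS le_eqVlt.
  by apply/orP; left; apply/eqP; field.
have C0 : 0 < 2 ^+ k * e ^+ 2 / 2.
  by rewrite divr_gt0// mulr_gt0 ?exprn_gt0.
have -> : 2 / e ^+ 2 * 2^-1 ^+ k = (2 ^+ k * e ^+ 2 / 2)^-1.
  rewrite exprVn; field; rewrite gt_eqF//= gt_eqF//; exact: exprn_gt0.
have -> : 1 - step k.+1 u = (1 - y) ^+ N by rewrite /step -/y -/N; ring.
rewrite -[leRHS]mul1r ler_pdivlMr//.
apply: (@le_trans _ _ ((1 - y) ^+ N * (1 + y) ^+ N)).
  apply: ler_wpM2l; first by rewrite exprn_ge0//; lra.
  by apply: (le_trans Nyge); apply: le_trans (bernoulli _ _); lra.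
by rewrite -exprMn exprn_ile1//; nra.
Qed.

Lemma cvg_half_expr : (2^-1 : R) ^+ k @[k --> \oo] --> (0 : R).
Proof. by apply: cvg_expr; rewrite ger0_norm; lra. Qed.

Lemma cvg_step_left u : 0 <= u <= 1 / 2 -> step k u @[k --> \oo] --> (0 : R).
Proof.
move=> u2; apply: (@squeeze_cvgr _ _ _ _ (cst 0) (fun k => 2^-1 ^+ k)).
- apply: nearW => k; rewrite step_left//= andbT.
  by have /andP[] : 0 <= step k u <= 1 by apply: step_itv01; lra.
- exact: cvg_cst.
- exact: cvg_half_expr.
Qed.

Lemma cvg_step_right u : 1 / 2 < u <= 1 -> step k u @[k --> \oo] --> (1 : R).
Proof.
move=> u2; rewrite -cvg_shiftS.
pose C := 2 / (2 * u - 1) ^+ 2.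
apply: (@squeeze_cvgr _ _ _ _ (fun k => 1 - C * 2^-1 ^+ k) (cst 1)).
- apply: nearW => k /=; have := step_right k u2; rewrite -/C.
  have /andP[] : 0 <= step k.+1 u <= 1 by apply: step_itv01; lra.
  by lra.
- rewrite -[X in _ --> X]subr0 -(mulr0 C); apply: cvgB; first exact: cvg_cst.
  by apply: cvgM; [exact: cvg_cst|exact: cvg_half_expr].
- exact: cvg_cst.
Qed.

End step_real.

(** * Feasible polynomials whose norm tends to the volume outside the set *)

Lemma lebesgue_rV_hyperrectangle_lty (R : realType) n (a b : 'rV[R]_n) :
  (lebesgue_rV R n (hyperrectangle a b) < +oo)%E.
Proof. by rewrite lebesgue_rV_hyperrectangle ltry. Qed.

Lemma measurable_semialg (R : realType) n m (g : 'I_m -> mpoly n R) :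
  measurable (semialg g).
Proof.
rewrite (_ : semialg g =
    \bigcap_(j in [set: 'I_m]) (peval (g j) @^-1` `[0, +oo[)).
  by apply: fin_bigcap_measurable => // j _; exact: measurable_peval_preimage.
apply/seteqP; split => [x gx j _|x gx j]; first by rewrite /= in_itv/= andbT.
by have := gx j I; rewrite /= in_itv/= andbT.
Qed.

Lemma not_semialg (R : realType) n m (g : 'I_m -> mpoly n R) x :
  ~ semialg g x -> exists j, negset g j x.
Proof.
by move=> /existsNP[j] /negP; rewrite -ltNge => gj; exists j.
Qed.

Lemma peval_step (R : realType) n k (p : mpoly n R) x :
  peval (step k p) x = step k (peval p x).
Proof. exact: (rmorph_step (meval (fun i => x ord0 i))). Qed.

Section approximants.
Context (R : realType) (n m : nat) (g : 'I_m -> mpoly n R) (a b : 'rV[R]_n).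
Let B := hyperrectangle a b.
Variable M : 'I_m -> R.
Hypothesis M_gt0 : forall j, 0 < M j.
Hypothesis gM : forall j x, B x -> `|peval (g j) x| <= M j.

Definition nonzero_constraint j := `[< exists x, peval (g j) x != 0 >].

Definition rescale j (t : R) := 1 / 2 + (2 * M j)^-1 * t.

Lemma rescale_itv01 j x : B x -> 0 <= rescale j (peval (g j) x) <= 1.
Proof.
move=> /(gM j); rewrite ler_norml => /andP[lb ub]; have M0 := M_gt0 j.
suff : -1 / 2 <= (2 * M j)^-1 * peval (g j) x <= 1 / 2 by rewrite /rescale; lra.
by rewrite [_^-1 * _]mulrC ler_pdivlMr ?ler_pdivrMr ?mulr_gt0//; lra.
Qed.

Lemma rescale_neg j t : t <= 0 -> rescale j t <= 1 / 2.
Proof.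
by move=> t0; rewrite /rescale gerDl pmulr_rle0// invr_gt0 mulr_gt0.
Qed.

Lemma rescale_pos j t : 0 < t -> 1 / 2 < rescale j t.
Proof.
by move=> t0; rewrite /rescale ltrDl pmulr_rgt0// invr_gt0 mulr_gt0.
Qed.

(** The summand 2^-k makes up for the product being only small, not zero, where
    a constraint is violated. *)
Definition approximant k : mpoly n R :=
  1 - \prod_(j | nonzero_constraint j)
        step k (mpolyC n (1 / 2) + (2 * M j)^-1 *: g j)
    + mpolyC n (2^-1 ^+ k).

Definition step_prod k x : R :=
  \prod_(j | nonzero_constraint j) step k (rescale j (peval (g j) x)).

Lemma peval_approximant k x :
  peval (approximant k) x = 1 - step_prod k x + 2^-1 ^+ k.
Proof.
rewrite /approximant /peval mevalD mevalB meval1 mevalC rmorph_prod.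
congr (_ - _ + _); apply: eq_bigr => j _.
by apply: (etrans (peval_step _ _ _)); rewrite /peval mevalD mevalC mevalZ.
Qed.

Lemma step_prod_itv01 k x : B x -> 0 <= step_prod k x <= 1.
Proof.
move=> Bx; have h j : 0 <= step k (rescale j (peval (g j) x)) <= 1.
  by apply/step_itv01/rescale_itv01.
apply/andP; split; last exact: prodr_ile1.
by apply: prodr_ge0 => j _; case/andP: (h j).
Qed.

Lemma negset_nonzero_constraint j x : negset g j x -> nonzero_constraint j.
Proof. by move=> gx; apply/asboolP; exists x; rewrite lt_eqF. Qed.

(** The violated constraint is among the factors because its polynomial is not
    identically zero; all factors lie in [0, 1]. *)
Lemma step_prod_negset k j x : B x -> negset g j x ->
  step_prod k x <= step k (rescale j (peval (g j) x)).
Proof.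
move=> Bx gx; have jn := negset_nonzero_constraint gx.
rewrite /step_prod (bigD1 j)//=.
have h i : 0 <= step k (rescale i (peval (g i) x)) <= 1.
  by apply/step_itv01/rescale_itv01.
rewrite ler_piMr//; first by case/andP: (h j).
exact: prodr_ile1.
Qed.

Lemma approximant_ge0 k x : B x -> 0 <= peval (approximant k) x.
Proof.
move=> Bx; rewrite peval_approximant.
by have := step_prod_itv01 k Bx; have : 0 <= 2^-1 ^+ k :> R by []; lra.
Qed.

Lemma approximant_ge1 k j x : B x -> negset g j x ->
  1 <= peval (approximant k) x.
Proof.
move=> Bx gx; rewrite peval_approximant.
have := step_prod_negset k Bx gx.
have : step k (rescale j (peval (g j) x)) <= 2^-1 ^+ k; last lra.
apply: step_left; have /andP[-> _] := rescale_itv01 j Bx.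
by rewrite rescale_neg// ltW.
Qed.

(** No factor sits at the threshold 1/2: on the semialgebraic set all of them
    tend to 1, and outside it one tends to 0 while the others stay in [0, 1]. *)
Lemma cvg_step_prod x : B x ->
    (forall j, nonzero_constraint j -> peval (g j) x != 0) ->
  step_prod k x @[k --> \oo] --> (\1_(semialg g) x : R).
Proof.
move=> Bx gx0; rewrite indicE; have [Kx|nKx] := pselect (semialg g x).
  rewrite mem_set//=.
  suff : step_prod k x @[k --> \oo] -->
      (\prod_(j | nonzero_constraint j) 1 : R).
    by rewrite big1.
  apply: (cvg_big (@mul_continuous R)) => j jn.
  apply: cvg_step_right; have /andP[_ ->] := rescale_itv01 j Bx.
  by rewrite rescale_pos// lt_neqAle eq_sym gx0// Kx.
have [j gj] := not_semialg nKx; rewrite memNset//=.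
apply: (@squeeze_cvgr _ _ _ _ (cst 0)
    (fun k => step k (rescale j (peval (g j) x)))).
- apply: nearW => k /=; rewrite step_prod_negset// andbT.
  by have /andP[] := step_prod_itv01 k Bx.
- exact: cvg_cst.
- apply: cvg_step_left; have /andP[-> _] := rescale_itv01 j Bx.
  by rewrite rescale_neg// ltW.
Qed.

Lemma cvg_approximant x : B x ->
    (forall j, nonzero_constraint j -> peval (g j) x != 0) ->
  peval (approximant k) x @[k --> \oo] --> (\1_(B `\` semialg g) x : R).
Proof.
move=> Bx gx0; under eq_fun do rewrite peval_approximant.
have -> : \1_(B `\` semialg g) x = 1 - \1_(semialg g) x + 0 :> R.
  rewrite addr0 !indicE in_setD mem_set//=.
  by case: (x \in semialg g) => /=; rewrite ?subr0 ?subrr.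
apply: cvgD; last exact: cvg_half_expr.
by apply: cvgB; [exact: cvg_cst|exact: cvg_step_prod].
Qed.

Lemma ae_nonzero_constraints : \forall x \ae lebesgue_rV R n,
  forall j, nonzero_constraint j -> peval (g j) x != 0.
Proof.
apply: filter_forall => j.
have [[x0 gx0]|jn] := pselect (exists x, peval (g j) x != 0).
  exists (peval (g j) @^-1` [set 0]); split.
  - exact: measurable_peval_preimage.
  - exact: (lebesgue_rV_zeros gx0).
  - by move=> x /= /not_implyP[_ /negP]; rewrite negbK => /eqP.
by apply: aeW => x /asboolP.
Qed.

Lemma cvg_norm1_approximant :
  poly_norm1 B (approximant k) @[k --> \oo] -->
  lebesgue_rV R n (B `\` semialg g).
Proof.
have mB : measurable B := measurable_hyperrectangle a b.
have mD : measurable (B `\` semialg g).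
  by apply: measurableD => //; exact: measurable_semialg.
have <- : (\int[lebesgue_rV R n]_(x in B) (\1_(B `\` semialg g) x)%:E =
    lebesgue_rV R n (B `\` semialg g))%E.
  by rewrite integral_indic// setIidl// => x [].
have [] // := @dominated_convergence _ _ R (lebesgue_rV R n) B mB
  (fun k x => (peval (approximant k) x)%:E)
  (fun x => (\1_(B `\` semialg g) x)%:E) (fun=> 2%:E).
- move=> k; apply/measurable_EFinP.
  by apply: measurable_funTS; exact: measurable_peval.
- by apply/measurable_EFinP; exact: measurable_indic.
- apply: filterS ae_nonzero_constraints => x gx0 Bx.
  apply: cvg_EFin; first by apply: nearW.
  exact: cvg_approximant.
- apply: (@measurable_bounded_integrable _ _ _ _ (fun=> 2)) => //.
    exact: lebesgue_rV_hyperrectangle_lty.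
  exact: bounded_cst.
- apply: aeW => x k Bx; rewrite lee_fin ger0_norm ?approximant_ge0//.
  rewrite peval_approximant; have := step_prod_itv01 k Bx.
  by have : 2^-1 ^+ k <= 1 :> R; [rewrite exprn_ile1//; lra|lra].
Qed.

End approximants.

(** The sequence is chosen independently of d: each [q k] competes with the
    minimizers of all large degrees. *)
Lemma exists_approximants (R : realType) n m (g : 'I_m -> mpoly n R)
    (a b : 'rV[R]_n) :
  exists q : nat -> mpoly n R,
    (forall k d, (msize (q k) <= d)%N ->
      feasible g (hyperrectangle a b) d (q k)) /\
    poly_norm1 (hyperrectangle a b) (q k) @[k --> \oo] -->
      lebesgue_rV R n (hyperrectangle a b `\` semialg g).
Proof.
have /choice[M /all_and2[M0 gM]] (j : 'I_m) : exists M : R, 0 < M /\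
    forall x, hyperrectangle a b x -> `|peval (g j) x| <= M.
  by have [M M0 gM] := peval_bounded (g j) a b; exists M.
exists (approximant g M); split; last exact: cvg_norm1_approximant.
move=> k d qd; split; first exact: leqW.
- by move=> x; exact: approximant_ge0.
- by move=> j x [gx Bx]; apply: (approximant_ge1 M0 gM _ _ gx).
Qed.

(** * Sublevel sets of the minimizers *)

Lemma le_lebesgue_rV (R : realType) n (A B : set 'rV[R]_n) :
  measurable A -> measurable B -> A `<=` B ->
  (lebesgue_rV R n A <= lebesgue_rV R n B)%E.
Proof. by move=> mA mB; apply: le_measure; exact: mem_set. Qed.

Lemma lebesgue_rV_interior_gt0 (R : realType) n (A : set 'rV[R]_n) :
  measurable A -> interior A !=set0 -> (0 < lebesgue_rV R n A)%E.
Proof.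
move=> mA [x /nbhs_ballP[e /= e0 xeA]].
pose c := const_mx (e / 2) : 'rV[R]_n.
apply: (@lt_le_trans _ _ (lebesgue_rV R n (hyperrectangle (x - c) (x + c)))).
  rewrite lebesgue_rV_hyperrectangle lte_fin prodr_gt0// => i _.
  by rewrite !mxE lt_max; apply/orP; right; lra.
apply: le_lebesgue_rV => //; first exact: measurable_hyperrectangle.
move=> y cy; apply: xeA; split => // i j; rewrite (ord1 i) /ball/=.
by have := cy j; rewrite !mxE => /andP[? ?]; rewrite ltr_norml; lra.
Qed.

(** A squeeze with two indices, suited to minima over polynomials of degree at
    most d: they are eventually below the value at any fixed competitor. *)
Lemma squeeze_cvge_above (R : realType) (u v : (\bar R)^nat) (l : \bar R) :
  l \is a fin_num -> (forall d, l <= u d)%E ->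
  (forall k, \forall d \near \oo, (u d <= v k)%E) ->
  v @ \oo --> l -> u @ \oo --> l.
Proof.
move=> lfin lu uv; rewrite -(fineK lfin) => /fine_cvgP[vfin vl].
have ubound (e : R) : 0 < e -> \forall d \near \oo, (u d <= (fine l + e)%:E)%E.
  move=> e0; have /cvgrPdist_le/(_ e e0) vle := vl.
  near \oo => k; have := uv k; apply: filterS => d /le_trans; apply.
  have vk : v k \is a fin_num by near: k.
  have : `|fine l - fine (v k)| <= e by near: k.
  by rewrite -[v k]fineK// lee_fin ler_norml => /andP[? ?] /=; lra.
have ufin : \forall d \near \oo, u d \is a fin_num.
  have := ubound 1 ltr01; apply: filterS => d ud.
  rewrite fin_real// (lt_le_trans _ (lu d)) ?ltNye_eq ?lfin//=.
  by rewrite (le_lt_trans ud) ?ltry.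
apply/fine_cvgP; split => //; apply/cvgrPdist_le => e e0.
have := ubound e e0; apply: filterS2 ufin => d ud.
have := lu d.
rewrite -(fineK ud) -[in X in X -> _](fineK lfin) !lee_fin /= => ? ?.
by rewrite ler_norml; lra.
Unshelve. all: by end_near. Qed.

Section sublevels.
Context (R : realType) (n m : nat) (g : 'I_m -> mpoly n R) (a b : 'rV[R]_n).
Let B := hyperrectangle a b.
Let mu := lebesgue_rV R n.

Lemma measurable_strict_sublevel1 (p : mpoly n R) :
  measurable (strict_sublevel1 B p).
Proof.
rewrite (_ : strict_sublevel1 B p = B `&` peval p @^-1` `]-oo, 1[).
  apply: measurableI; first exact: measurable_hyperrectangle.
  exact: measurable_peval_preimage.
by apply/seteqP; split => x /=; rewrite in_itv.
Qed.

Lemma measurable_sublevel1 (p : mpoly n R) : measurable (sublevel1 B p).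
Proof.
rewrite (_ : sublevel1 B p = B `&` peval p @^-1` `]-oo, 1]).
  apply: measurableI; first exact: measurable_hyperrectangle.
  exact: measurable_peval_preimage.
by apply/seteqP; split => x /=; rewrite in_itv.
Qed.

Lemma strict_sublevel1_sub d p : feasible g B d p ->
  strict_sublevel1 B p `<=` semialg g.
Proof.
move=> [_ _ p1] x [Bx px]; apply: contrapT => /not_semialg[j gx].
by have := p1 j x (conj gx Bx); rewrite leNgt px.
Qed.

(** Markov's inequality at level 1. *)
Lemma le_norm1 d p : feasible g B d p ->
  (mu (B `\` strict_sublevel1 B p) <= poly_norm1 B p)%E.
Proof.
move=> [_ p0 _]; have mB : measurable B := measurable_hyperrectangle a b.
have mD : measurable (B `\` strict_sublevel1 B p).
  by apply: measurableD => //; exact: measurable_strict_sublevel1.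
have <- : (\int[mu]_(x in B) (\1_(B `\` strict_sublevel1 B p) x)%:E =
    mu (B `\` strict_sublevel1 B p))%E.
  by rewrite integral_indic// setIidl// => x [].
apply: ge0_le_integral => //.
- by apply/measurable_EFinP; exact: measurable_indic.
- by apply/measurable_EFinP; apply: measurable_funTS; exact: measurable_peval.
- move=> x Bx; rewrite lee_fin indicE; case: (boolP (x \in _)).
    2: by move=> _; exact: p0.
  by move=> /set_mem[_ /not_andP[//|/negP]]; rewrite -leNgt.
Qed.

(** Passing to complements in B, whose volume is finite, turns the claim into
    the squeeze between vol (B \ K) and the norms of the approximants. *)
Lemma cvg_strict_sublevel1 (p : nat -> mpoly n R) :
  semialg g `<=` B -> (forall d, is_minimizer g B d (p d)) ->
  mu (strict_sublevel1 B (p d)) @[d --> \oo] --> mu (semialg g).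
Proof.
move=> KB pmin; have mB : measurable B := measurable_hyperrectangle a b.
have Bfin : (mu B < +oo)%E := lebesgue_rV_hyperrectangle_lty a b.
have muC A : measurable A -> A `<=` B -> mu A = (mu B - mu (B `\` A))%E.
  move=> mA AB; rewrite -[in LHS](setIidr AB) -setDD.
  by rewrite measureD ?setIDA ?setIid//; exact: measurableD.
have mK := measurable_semialg g.
have mS d := measurable_strict_sublevel1 (p d).
have SK d : strict_sublevel1 B (p d) `<=` semialg g.
  by apply: strict_sublevel1_sub; exact: (pmin d).1.
have DKfin : mu (B `\` semialg g) \is a fin_num.
  rewrite ge0_fin_numE//; apply: le_lt_trans Bfin.
  by apply: le_lebesgue_rV => //; exact: measurableD.
rewrite (muC _ mK KB).
under eq_fun => d do rewrite (muC _ (mS d) (subset_trans (SK d) KB)).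
apply: cvgeB; [by rewrite fin_num_adde_defl// fin_numN|exact: cvg_cst|].
have [q [qfeas qcvg]] := exists_approximants g a b.
apply: (squeeze_cvge_above DKfin _ _ qcvg).
  move=> d; apply: le_lebesgue_rV; [exact: measurableD..|].
  by move=> x [Bx nKx]; split => // /SK.
move=> k; exists (msize (q k)) => // d /= qd.
apply: (le_trans (le_norm1 (pmin d).1)); apply: (pmin d).2.
exact: qfeas.
Qed.

(** A point of the strict sublevel set shows that p - 1 is not identically zero,
    so the level set p = 1 is null. *)
Lemma sublevel1_measure (p : mpoly n R) : strict_sublevel1 B p !=set0 ->
  mu (sublevel1 B p) = mu (strict_sublevel1 B p).
Proof.
move=> [x0 [Bx0 px0]]; pose Z := [set x | peval (p - 1) x = 0].
have pevalB1 x : peval (p - 1) x = peval p x - 1.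
  by rewrite /peval mevalB meval1.
have mZ : measurable Z.
  exact: (measurable_peval_preimage (p - 1) (measurable_set1 0)).
have Z0 : mu Z = 0%E.
  by apply: (@lebesgue_rV_zeros _ _ _ x0); rewrite pevalB1 subr_eq0 lt_eqF.
have mS := measurable_strict_sublevel1 p.
apply/eqP; rewrite eq_le; apply/andP; split; last first.
  apply: le_lebesgue_rV => //; first exact: measurable_sublevel1.
  by move=> x [Bx px]; split => //; exact: ltW.
apply: (@le_trans _ _ (mu (strict_sublevel1 B p `|` Z))).
  apply: le_lebesgue_rV.
  - exact: measurable_sublevel1.
  - exact: measurableU.
  - move=> x [Bx]; rewrite le_eqVlt => /orP[/eqP px|px]; last by left.
    by right; rewrite /Z/= pevalB1 px subrr.
have : (mu (strict_sublevel1 B p `|` Z) <= mu (strict_sublevel1 B p) + mu Z)%E.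
  exact: measureU2.
by rewrite Z0 adde0.
Qed.

End sublevels.

Theorem corollary1 (R : realType) (n m : nat) (g : 'I_m -> mpoly n R)
    (a b : 'rV[R]_n) (p : nat -> mpoly n R)
    (Kcompact : compact (semialg g))
    (Kinterior : interior (semialg g) !=set0)
    (KB : semialg g `<=` hyperrectangle a b)
    (pmin : forall d : nat, is_minimizer g (hyperrectangle a b) d (p d)) :
  [/\ forall d : nat, strict_sublevel1 (hyperrectangle a b) (p d) `<=` semialg g,
      lebesgue_rV R n (strict_sublevel1 (hyperrectangle a b) (p d))
        @[d --> \oo] --> lebesgue_rV R n (semialg g)
    & lebesgue_rV R n (sublevel1 (hyperrectangle a b) (p d))
        @[d --> \oo] --> lebesgue_rV R n (semialg g)].
Proof.
have cvgS := cvg_strict_sublevel1 KB pmin.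
split => //.
  by move=> d; apply: strict_sublevel1_sub; exact: (pmin d).1.
apply: cvg_trans (cvgS); apply: near_eq_cvg.
have K0 := lebesgue_rV_interior_gt0 (measurable_semialg g) Kinterior.
have S0 : \forall d \near \oo,
    (0 < lebesgue_rV R n (strict_sublevel1 (hyperrectangle a b) (p d)))%E.
  exact: cvgS (open_ereal_gt' K0).
apply: filterS S0 => d Sd0; apply/esym/sublevel1_measure.
apply/set0P; apply: contraTneq Sd0 => ->.
by rewrite measure0 ltxx.
Qed.
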